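(* Let $G$ be a group, let $f: G \to \mathbb{R}$ be a homogeneous quasimorphism with defect $D(f)$, and let $\leq_f$ be the invariant partial order on $G$ given by $$g <_f h \iff f(h^{-1}g) < -D(f).$$ Then $\leq_f$ is admissible, and for any $g \in G^{++}$ and $h \in G$ the corresponding relative growth is given by $$\gamma(g,h) = \frac{f(h)}{f(g)}.$$ In particular, up to positive multiple every quasimorphism arises as the relative growth of some partial order with respect to any dominant.
   Context: A homogeneous quasimorphism on a group $G$ is a map $f: G \to \mathbb{R}$ with $f(g^n) = n f(g)$ for all $g \in G$, $n \in \mathbb{Z}$, such that $(g,h) \mapsto f(gh) - f(g) - f(h)$ is bounded on $G \times G$; its defect is $D(f) := \sup_{g,h \in G}(f(gh) - f(g) - f(h))$. A partial order $\leq$ on $G$ is invariant if $g \leq h$ implies $kg \leq kh$ and $gk \leq hk$ for all $g,h,k\in G$. Its order semigroup is $G^+ := \{g \in G \mid g \geq e\}$, and its set of dominants is $G^{++} := \{g \in G^+ \setminus\{e\} \mid \forall h \in G\ \exists n \in \mathbb{N}: g^n \geq h\}$. The order is admissible if $G^{++} \neq \emptyset$. For $g \in G^{++}$, $h \in G$ the relative growth is $\gamma(g,h) := \lim_{n \to \infty} \frac{1}{n}\min\{p \in \mathbb{Z} \mid g^p \geq h^n\}$. In the claim, $G^{++}$ and $\gamma$ refer to $\leq_f$, where $g \leq_f h$ means $g <_f h$ or $g = h$.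
   Formalization: Admissibility and the ''in particular'' clause are stated only for f not identically zero: for f = 0 the defect is 0, the order is equality, there are no dominants, and the order is not admissible. *)

(* Defs.v *)
From HB Require Import structures.
From mathcomp Require Import all_boot all_order all_algebra.
From mathcomp Require Import all_classical all_reals all_analysis.

Set Implicit Arguments.
Unset Strict Implicit.
Unset Printing Implicit Defensive.

Import Order.TTheory GRing.Theory Num.Theory.
Import numFieldNormedType.Exports.

Local Open Scope classical_set_scope.
Local Open Scope ring_scope.

(* [groupType] (mathcomp.boot.monoid) is the structure of arbitrary, possibly
   infinite, groups; its operations are parsed in [%g].  The library only
   provides powers with exponents in [nat]. *)
Definition expgz (G : groupType) (g : G) (m : int) : G :=
  match m with
  | Posz n => (g ^+ n)%g
  | Negz n => (g ^- n.+1)%g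
  end.

Definition homogeneous_quasimorphism (G : groupType) (R : realType)
    (f : G -> R) : Prop :=
  (forall (g : G) (m : int), f (expgz g m) = m%:~R * f g) /\
  (exists C : R, forall g h : G, `|f (g * h)%g - f g - f h| <= C).

Definition defect (G : groupType) (R : realType) (f : G -> R) : R :=
  sup (range (fun gh : G * G => f (gh.1 * gh.2)%g - f gh.1 - f gh.2)).

Definition invariant_partial_order (G : groupType) (le : rel G) : Prop :=
  [/\ reflexive le, antisymmetric le, transitive le &
      forall g h k : G, le g h -> le (k * g)%g (k * h)%g /\ le (g * k)%g (h * k)%g].

Definition order_semigroup (G : groupType) (le : rel G) : set G :=
  [set g | le 1%g g].

Definition dominants (G : groupType) (le : rel G) : set G :=
  [set g | (order_semigroup le `\ 1%g) g /\
           forall h : G, exists n : nat, le h (g ^+ n)%g].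

Definition admissible (G : groupType) (le : rel G) : Prop :=
  dominants le !=set0.

Definition minima (A : set int) : set int := A `&` lbound A.

Definition growth_exponents (G : groupType) (le : rel G) (g h : G) (n : nat) :
    set int :=
  [set p | le (h ^+ n)%g (expgz g p)].

(* The value at [n = 0] is irrelevant for the limit; [xget] yields the default
   value 0 when there is no minimum. *)
Definition growth_seq (G : groupType) (R : realType) (le : rel G) (g h : G) :
    R^nat :=
  fun n => n%:R^-1 * (xget 0 (minima (growth_exponents le g h n)))%:~R.

Definition relative_growth (G : groupType) (R : realType) (le : rel G)
    (g h : G) : R :=
  limn (growth_seq R le g h).

(* The minima and the limit in the definition of the relative growth exist,
   i.e. no default value enters in [relative_growth]. *)
Definition relative_growth_exists (G : groupType) (R : realType) (le : rel G)
    (g h : G) : Prop :=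
  (forall n, minima (growth_exponents le g h n) !=set0) /\
  cvgn (growth_seq R le g h).

Definition quasimorphism_lt (G : groupType) (R : realType) (f : G -> R) : rel G :=
  fun g h => f (h^-1 * g)%g < - defect f.

Definition quasimorphism_le (G : groupType) (R : realType) (f : G -> R) : rel G :=
  fun g h => quasimorphism_lt f g h || (g == h).

(* Main.v *)
Require Import Defs.
From HB Require Import structures.
From mathcomp Require Import all_boot all_order all_algebra.
From mathcomp Require Import all_classical all_reals all_analysis.
From mathcomp Require Import lra.

Set Implicit Arguments.
Unset Strict Implicit.
Unset Printing Implicit Defensive.

Import Order.TTheory GRing.Theory Num.Theory.
Import numFieldNormedType.Exports.

Local Open Scope classical_set_scope.
Local Open Scope ring_scope.

(** For a homogeneous quasimorphism f with defect D, the value f (g h)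
    lies within D of f g + f h: the lower estimate follows from the upper one
    because f (x^-1) = - f x.  Together with the invariance of f under
    conjugation (f (g^k) and f g have multiples at bounded distance, hence are
    equal) this makes the strict relation f (h^-1 g) < - D transitive,
    asymmetric and bi-invariant.

    The order is then squeezed between two relations that only see the values
    of f: g <= h forces f g <= f h (quasimorphism_le_monotone), and
    f g + 2 D < f h forces g <= h (quasimorphism_le_gap).  The elements strictly
    above 1 are those with f g > D >= 0, and each of them is dominant, since
    f (g^n) = n f g eventually exceeds f h + 2 D; if f g <> 0, some power of g,
    with positive or negative exponent, is of this kind.  For the growth, the
    integers p with g^p >= h^n all satisfy p >= n f h / f g, and every p with
    p > n f h / f g + 2 D / f g is among them.  So the least such p exists and
    stays at bounded distance from n f h / f g; dividing by n, the error
    vanishes in the limit.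

    Consequently f is recovered, up to the positive factor f g, as the relative
    growth of its own order with respect to any dominant g. *)

(** * Integers and sequences at bounded distance *)

(** The Archimedean property, in the form used for homogeneous maps. *)
Lemma eq_of_bounded_multiples (R : realType) (a b C : R) :
  (forall n : nat, `|n%:R * a - n%:R * b| <= C) -> a = b.
Proof.
move=> bnd; apply/eqP; rewrite -subr_eq0 -normr_eq0; apply/negP => /negP ab0.
have ab_gt0 : 0 < `|a - b| by rewrite lt_neqAle eq_sym ab0 normr_ge0.
have := bnd (Num.bound (C / `|a - b|)).
rewrite -mulrBr normrM normr_nat -ler_pdivlMr // leNgt => /negP; apply.
exact: unstable.ltr_bound.
Qed.

(** The shift by the lower bound [q] reduces this to the well-ordering of the
    natural numbers. *)
Lemma minima_nonempty (A : set int) (p q : int) :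
  A p -> lbound A q -> minima A !=set0.
Proof.
move=> Ap lbq.
have ex : exists k : nat, `[< A (q + k%:Z) >].
  exists `|p - q|%N; apply/asboolP; rewrite gez0_abs ?subr_ge0; last exact: lbq.
  by rewrite addrCA subrr addr0.
case: (ex_minnP ex) => k /asboolP Ak kmin; exists (q + k%:Z); split => // r Ar.
have qr := lbq _ Ar; rewrite -lerBrDl -(@gez0_abs (r - q)) ?subr_ge0 // lez_nat.
apply: kmin; apply/asboolP; rewrite gez0_abs ?subr_ge0 //.
by rewrite addrCA subrr addr0.
Qed.

Lemma quotient_cvg (R : realType) (u : R^nat) (a K : R) :
  (forall n : nat, n%:R * a <= u n <= n%:R * a + K) ->
  n%:R^-1 * u n @[n --> \oo] --> a.
Proof.
move=> bnd.
(* The index 0 is skipped: there the quotient is 0, whatever [a] is. *)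
rewrite -cvg_shiftS.
apply: (@squeeze_cvgr _ _ _ _ (fun=> a) (fun n => a + K * n.+1%:R^-1)).
- near=> n; have n0 : (0 : R) < n.+1%:R by rewrite ltr0n.
  have /andP[lo hi] := bnd n.+1; apply/andP; split.
    by rewrite ler_pdivlMl.
  by rewrite ler_pdivrMl // mulrDr mulrCA divff ?mulr1 // gt_eqF.
- exact: cvg_cst.
- rewrite -[X in _ --> X]addr0; apply: cvgD; first exact: cvg_cst.
  rewrite -(mulr0 K); apply: cvgM; [exact: cvg_cst|exact: cvg_harmonic].
Unshelve. all: by end_near. Qed.

(** * Homogeneous quasimorphisms *)

Section HomogeneousQuasimorphism.
Variables (G : groupType) (R : realType) (f : G -> R).
Hypothesis hf : homogeneous_quasimorphism f.
Implicit Types (g h k : G) (n : nat) (p : int).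

Local Notation D := (defect f).
Local Notation le_f := (quasimorphism_le f).

Lemma quasimorphismX g n : f (g ^+ n)%g = n%:R * f g.
Proof. exact: (hf.1 g n%:Z). Qed.

Lemma quasimorphismV g : f (g^-1)%g = - f g.
Proof. by rewrite (hf.1 g (Negz 0)) NegzE mulN1r. Qed.

Lemma quasimorphism1 : f 1%g = 0.
Proof. by rewrite -(expg0 1%g) quasimorphismX mul0r. Qed.

Lemma quasimorphismM_le g h : f (g * h)%g <= f g + f h + D.
Proof.
have [_ [C bnd]] := hf.
suff : f (g * h)%g - f g - f h <= D by lra.
apply: ub_le_sup; last by exists (g, h).
exists C => _ [[x y] _ <-] /=; exact: le_trans (ler_norm _) (bnd x y).
Qed.

(** The defect is a supremum of signed differences; passing to inverses turns
    the upper estimate into the lower one. *)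
Lemma quasimorphismM_ge g h : f g + f h - D <= f (g * h)%g.
Proof.
have := quasimorphismM_le h^-1%g g^-1%g.
by rewrite -invgM !quasimorphismV; lra.
Qed.

Lemma defect_ge0 : 0 <= D.
Proof. by have := quasimorphismM_le 1%g 1%g; rewrite mulg1 quasimorphism1; lra. Qed.

(** Conjugation by [k] changes [f] by at most [2 * D], as [f k] and [f k^-1]
    cancel.  It commutes with powers, so the same bound holds for all multiples
    of the difference. *)
Lemma quasimorphismJ g k : f (g ^ k)%g = f g.
Proof.
apply: (@eq_of_bounded_multiples _ _ _ (2 * D)) => n.
rewrite -!quasimorphismX -conjXg conjgE.
set x := (g ^+ n)%g; rewrite ler_norml.
have := quasimorphismM_le k^-1%g (x * k)%g.
have := quasimorphismM_ge k^-1%g (x * k)%g.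
have := quasimorphismM_le x k; have := quasimorphismM_ge x k.
rewrite quasimorphismV; lra.
Qed.

(** * The order of a quasimorphism *)

(** The negative slack [- D] in each of the two inequalities pays for the one
    error [D] made by adding them. *)
Lemma quasimorphism_lt_trans : transitive (quasimorphism_lt f).
Proof.
move=> h g k; rewrite /quasimorphism_lt => gh hk.
have := quasimorphismM_le (k^-1 * h)%g (h^-1 * g)%g.
by rewrite mulgA mulgK; lra.
Qed.

Lemma quasimorphism_lt_asym g h :
  quasimorphism_lt f g h -> quasimorphism_lt f h g -> False.
Proof.
rewrite /quasimorphism_lt => gh; rewrite -(invgK (g^-1 * h)%g) invgM invgK.
rewrite quasimorphismV; have := defect_ge0; lra.
Qed.

Lemma quasimorphism_lt_mul2l g h k :
  quasimorphism_lt f (k * g)%g (k * h)%g = quasimorphism_lt f g h.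
Proof. by rewrite /quasimorphism_lt invgM -mulgA mulKg. Qed.

(** Right translation conjugates [h^-1 * g]. *)
Lemma quasimorphism_lt_mul2r g h k :
  quasimorphism_lt f (g * k)%g (h * k)%g = quasimorphism_lt f g h.
Proof.
by rewrite /quasimorphism_lt invgM -mulgA (mulgA h^-1%g) -conjgE quasimorphismJ.
Qed.

Lemma quasimorphism_le_invariant : invariant_partial_order le_f.
Proof.
split.
- by move=> g; rewrite /quasimorphism_le eqxx orbT.
- move=> g h /andP[/orP[gh|/eqP//] /orP[hg|/eqP//]].
  by case: (quasimorphism_lt_asym gh hg).
- move=> h g k /orP[gh|/eqP-> //] /orP[hk|/eqP<-]; rewrite /quasimorphism_le.
    by rewrite (quasimorphism_lt_trans gh hk).
  by rewrite gh.
- move=> g h k; rewrite /quasimorphism_le quasimorphism_lt_mul2l.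
  by rewrite quasimorphism_lt_mul2r (inj_eq (mulgI k)) (inj_eq (mulIg k)) => ->.
Qed.

(** This and the next lemma enclose the order between two relations defined by
    the values of [f] alone, and these two already determine the growth. *)
Lemma quasimorphism_le_monotone g h : le_f g h -> f g <= f h.
Proof.
move=> /orP[|/eqP-> //]; rewrite /quasimorphism_lt => gh.
by have := quasimorphismM_ge h^-1%g g; rewrite quasimorphismV; lra.
Qed.

Lemma quasimorphism_le_gap g h : f g + 2 * D < f h -> le_f g h.
Proof.
move=> gh; apply/orP; left; rewrite /quasimorphism_lt.
by have := quasimorphismM_le h^-1%g g; rewrite quasimorphismV; lra.
Qed.

(** Every element strictly above 1 is dominant: it satisfies [D < f g], hence
    [0 < f g], and [f (g ^+ n)] is unbounded. *)
Lemma quasimorphism_dominantsP g : dominants le_f g <-> D < f g.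
Proof.
split=> [[[/orP[|/eqP<-]]]|gD].
- by rewrite /quasimorphism_lt mulg1 quasimorphismV; lra.
- by move=> /(_ erefl).
have f_gt0 : 0 < f g by have := defect_ge0; lra.
split; first split.
- by apply/orP; left; rewrite /quasimorphism_lt mulg1 quasimorphismV; lra.
- by move=> /= g1; move: f_gt0; rewrite g1 quasimorphism1 ltxx.
move=> h; exists (Num.bound ((f h + 2 * D) / f g)).
apply: quasimorphism_le_gap; rewrite quasimorphismX -ltr_pdivrMr //.
exact: unstable.ltr_bound.
Qed.

Lemma quasimorphism_le_admissible g : f g <> 0 -> admissible le_f.
Proof.
wlog f_gt0 : g / 0 < f g => [wl fg0|_].
  have [fg|fg|//] := ltrgt0P (f g).
    exact: (wl g).
  by apply: (wl g^-1%g); rewrite quasimorphismV; lra.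
exists (g ^+ Num.bound (D / f g))%g; apply/quasimorphism_dominantsP.
rewrite quasimorphismX -ltr_pdivrMr //; exact: unstable.ltr_bound.
Qed.

(** * Relative growth *)

Section RelativeGrowth.
Variables (g h : G).
Hypothesis f_gt0 : 0 < f g.

Lemma growth_exponents_ge n p :
  growth_exponents le_f g h n p -> n%:R * (f h / f g) <= p%:~R.
Proof.
move=> /quasimorphism_le_monotone; rewrite quasimorphismX hf.1 => le_np.
by rewrite mulrA ler_pdivrMr.
Qed.

Lemma growth_exponents_gt n p :
  n%:R * (f h / f g) + 2 * D / f g < p%:~R -> growth_exponents le_f g h n p.
Proof.
move=> lt_np; apply: quasimorphism_le_gap; rewrite quasimorphismX hf.1.
by rewrite -ltr_pdivrMr // mulrDl -mulrA.
Qed.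

(** The least integer exceeding the threshold of [growth_exponents_gt]. *)
Let growth_witness n : int :=
  Num.floor (n%:R * (f h / f g) + 2 * D / f g) + 1.

Lemma growth_witnessP n : growth_exponents le_f g h n (growth_witness n).
Proof. by apply: growth_exponents_gt; exact: floorD1_gt. Qed.

Lemma growth_minima_nonempty n : minima (growth_exponents le_f g h n) !=set0.
Proof.
apply: (minima_nonempty (growth_witnessP n)
          (q := Num.floor (n%:R * (f h / f g)))) => p /growth_exponents_ge.
move=> le_np; rewrite -(ler_int R); exact: le_trans (floor_le _) le_np.
Qed.

(** The least exponent lies between [n * (f h / f g)] and the witness, which
    exceeds that lower bound by at most [2 * D / f g + 1]. *)
Lemma growth_seq_cvg :
  growth_seq R le_f g h n @[n --> \oo] --> f h / f g.
Proof.
apply: (@quotient_cvg _ _ _ (2 * D / f g + 1)) => n.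
have [min_in min_lb] := xgetPex 0 (growth_minima_nonempty n).
rewrite growth_exponents_ge //=.
have := min_lb _ (growth_witnessP n); rewrite -(ler_int R) => /le_trans; apply.
rewrite intrD addrA lerD2r; exact: floor_le.
Qed.

End RelativeGrowth.

End HomogeneousQuasimorphism.

Theorem proposition1p3 (G : groupType) (R : realType) (f : G -> R)
    (hf : homogeneous_quasimorphism f) :
  [/\ invariant_partial_order (quasimorphism_le f),
      (exists g : G, f g <> 0) -> admissible (quasimorphism_le f),
      forall g h : G, dominants (quasimorphism_le f) g ->
        relative_growth_exists R (quasimorphism_le f) g h /\
        relative_growth R (quasimorphism_le f) g h = f h / f g
    & (exists g : G, f g <> 0) ->
      exists le : rel G,
        [/\ invariant_partial_order le, admissible le
          & forall g : G, dominants le g ->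
            exists c : R, 0 < c /\
              forall h : G,
                relative_growth_exists R le g h /\
                f h = c * relative_growth R le g h]].
Proof.
have dom_gt0 g : dominants (quasimorphism_le f) g -> 0 < f g.
  by move=> /(quasimorphism_dominantsP hf); apply: le_lt_trans (defect_ge0 hf).
have growth g h : dominants (quasimorphism_le f) g ->
    relative_growth_exists R (quasimorphism_le f) g h /\
    relative_growth R (quasimorphism_le f) g h = f h / f g.
  move=> /dom_gt0 g0; have cvg_g := growth_seq_cvg hf (h := h) g0.
  split; last exact: cvg_lim cvg_g.
  by split; [exact: growth_minima_nonempty | apply/cvg_ex; exists (f h / f g)].
have adm : (exists g : G, f g <> 0) -> admissible (quasimorphism_le f).
  by case=> g; exact: quasimorphism_le_admissible.
have inv := quasimorphism_le_invariant hf.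
split=> // nz; exists (quasimorphism_le f); split=> // [|g gdom]; first exact: adm.
exists (f g); split=> [|h]; first exact: dom_gt0.
have [ex ->] := growth g h gdom; split=> //.
by rewrite mulrC divfK // gt_eqF // dom_gt0.
Qed.
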